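(* Let $X=(X,\phi,\varepsilon(X))$ be an exterior discrete semi-flow such that $(X,\phi)$ is Lagrange stable at every point of $\mathrm{PA}(\bar L(X))$. Then: (i) $\mathrm{PA}(\bar L(X))\setminus \mathrm{WA}(\bar L(X)\setminus L(X))\subset \bar D(X)$; (ii) if, in addition, $\mathrm{WA}(\bar L(X)\setminus L(X))=\emptyset$, then $\mathrm{A}(\bar L(X))=\bar D(X)$.
   Context: $\mathbb{N}=\{0,1,2,\dots\}$. An externology on a topological space $X$ is a non-empty collection $\varepsilon(X)$ of open subsets of $X$, closed under finite intersections, such that if $E\in\varepsilon(X)$ and $U$ is open with $E\subset U$, then $U\in\varepsilon(X)$. A topological space with an externology is an exterior space. A map $f$ from $(X,\varepsilon(X))$ to $(X',\varepsilon(X'))$ is exterior if it is continuous and $f^{-1}(E')\in\varepsilon(X)$ for all $E'\in\varepsilon(X')$. A discrete semi-flow on a topological space $X$ is a continuous map $\phi\colon\mathbb{N}\times X\to X$ ($\mathbb{N}$ discrete) with $\phi(0,x)=x$ and $\phi(n,\phi(m,x))=\phi(n+m,x)$; write $\phi^n(x)=n\cdot x=\phi(n,x)$. An exterior discrete semi-flow $(X,\phi,\varepsilon(X))$ is an exterior space $(X,\varepsilon(X))$ with a discrete semi-flow $\phi$ such that $\phi^1\colon X\to X$ is exterior. Limit space: $L(X)=\bigcap_{E\in\varepsilon(X)}E$; bar-limit space: $\bar L(X)=\bigcap_{E\in\varepsilon(X)}\overline{E}$. $\bar D(X)$ is the set of $x\in X$ such that for every $E\in\varepsilon(X)$ there is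 $n_E\in\mathbb{N}$ with $\phi^n(x)\in\overline{E}$ for all $n\ge n_E$. Omega-limit: $\Lambda(x)=\bigcap_{n\ge 0}\overline{\{m\cdot x\mid m\ge n\}}$. For $S\subset X$: $\mathrm{PA}(S)=\{x\in X\mid\Lambda(x)\subset S\}$, $\mathrm{WA}(S)=\{x\in X\mid\Lambda(x)\cap S\neq\emptyset\}$, $\mathrm{A}(S)=\{x\in X\mid\emptyset\neq\Lambda(x)\subset S\}$. $(X,\phi)$ is Lagrange stable at $x$ if $\overline{\{n\cdot x\mid n\in\mathbb{N}\}}$ is compact. *)

(* Defs.v *)
From mathcomp Require Import all_boot all_order.
From mathcomp Require Import all_classical all_reals all_analysis.

Set Implicit Arguments.
Unset Strict Implicit.
Unset Printing Implicit Defensive.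

Local Open Scope classical_set_scope.

(* The empty intersection is the whole space, which belongs to every externology
   by non-emptiness and upward closure. *)
Record is_externology (X : topologicalType) (eps : set (set X)) : Prop := {
  externology_nonempty : eps !=set0 ;
  externology_open : forall E, eps E -> open E ;
  externology_setI : forall E F, eps E -> eps F -> eps (E `&` F) ;
  externology_sup : forall E U, eps E -> open U -> E `<=` U -> eps U }.

Definition exterior_map (X Y : topologicalType) (epsX : set (set X))
    (epsY : set (set Y)) (f : X -> Y) : Prop :=
  continuous f /\ forall E, epsY E -> epsX (f @^-1` E).

(* [nat] carries its discrete topology and [nat * X] the product topology. *)
Record is_discrete_semiflow (X : topologicalType) (phi : nat * X -> X) : Prop := {
  semiflow_continuous : continuous phi ;
  semiflow0 : forall x, phi (0, x) = x ;
  semiflowD : forall n m x, phi (n, phi (m, x)) = phi (n + m, x) }.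

Record is_exterior_discrete_semiflow (X : topologicalType) (phi : nat * X -> X)
    (eps : set (set X)) : Prop := {
  exterior_semiflow_externology : is_externology eps ;
  exterior_semiflow_semiflow : is_discrete_semiflow phi ;
  exterior_semiflow_map : exterior_map eps eps (fun x => phi (1, x)) }.

Section ExteriorSemiflow.
Variables (X : topologicalType) (phi : nat * X -> X) (eps : set (set X)).

Definition limit_space : set X := \bigcap_(E in eps) E.

Definition bar_limit_space : set X := \bigcap_(E in eps) closure E.

Definition barD : set X :=
  [set x | forall E, eps E ->
    exists nE, forall n, nE <= n -> closure E (phi (n, x))].

Definition omega_limit (x : X) : set X :=
  \bigcap_(n in [set: nat]) closure [set phi (m, x) | m in [set m | n <= m]].

Definition PA (S : set X) : set X := [set x | omega_limit x `<=` S].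

Definition WA (S : set X) : set X := [set x | omega_limit x `&` S !=set0].

Definition attraction (S : set X) : set X :=
  [set x | omega_limit x !=set0 /\ omega_limit x `<=` S].

(* [compact] is quasi-compactness; no separation axiom is involved. *)
Definition lagrange_stable_at (x : X) : Prop :=
  compact (closure [set phi (n, x) | n in [set: nat]]).

End ExteriorSemiflow.

(* Main.v *)
Require Import Defs.
From mathcomp Require Import all_boot all_order.
From mathcomp Require Import all_classical all_reals all_analysis.

Local Open Scope classical_set_scope.

(** Everything rests on one compactness principle: when the orbit closure of
    [x] is compact, a closed set visited by the orbit at arbitrarily late times
    contains a point of the omega-limit of [x] ([omega_limit_frequently]).
    Applied to the whole space, it says that the omega-limit is non-empty;
    applied to the complement of an open set [U], it says that an orbit whose
    omega-limit lies in [U] is eventually inside [U]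
    ([omega_limit_eventually]).

    For (i), the omega-limit of [x] lies in the bar-limit space and avoids
    the part of it outside the limit space, so it lies in the limit space,
    hence in every [E] of the externology. As [E] is open, the orbit eventually
    stays in [E], and a fortiori in the closure of [E].

    For (ii), one inclusion is (i). Conversely, if the orbit is eventually in
    the closure of each [E], then so is its omega-limit
    ([omega_limit_sub_closed]), which therefore lies in the bar-limit space; the
    stability hypothesis then applies to [x] and makes the omega-limit
    non-empty. *)

Section OmegaLimit.
Variables (X : topologicalType) (phi : nat * X -> X) (x : X).

(** The times at which the orbit is in [C] form a cofinal subset of [nat], so
    the orbit restricted to them still defines a proper filter, and a cluster
    point of that filter lies both in [C] and in the closure of every tail. *)
Lemma omega_limit_frequently (C : set X) :
  lagrange_stable_at phi x -> closed C ->
  (forall n, exists2 m, n <= m & C (phi (m, x))) ->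
  omega_limit phi x `&` C !=set0.
Proof.
move=> cK cC freq.
pose visits := (fun m => phi (m, x)) @^-1` C.
pose F := (fun m => phi (m, x)) @ within visits \oo.
have PF : ProperFilter F.
  apply: fmap_proper_filter; apply: Build_ProperFilter_ex => P.
  rewrite /within => -[n _ nP].
  by have [m nm Cm] := freq n; exists m; apply: nP.
have FK : F (closure [set phi (n, x) | n in [set: nat]]).
  by exists 0 => // m _ _; apply: subset_closure; exists m.
have [p [_]] := cK F PF FK.
rewrite clusterE => Fp; exists p; split.
  move=> n _; apply: Fp.
  by exists n => // m nm _; exists m.
rewrite ((closure_id C).1 cC); apply: Fp.
by exists 0.
Qed.

Lemma omega_limit_nonempty :
  lagrange_stable_at phi x -> omega_limit phi x !=set0.
Proof.
move=> cK; have [||p [wp _]] := omega_limit_frequently setT cK.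
- exact: closedT.
- by move=> n; exists n.
- by exists p.
Qed.

(** Otherwise the orbit would visit the closed set [~` U] at arbitrarily late
    times and would have a limit point there. *)
Lemma omega_limit_eventually (U : set X) :
  lagrange_stable_at phi x -> open U -> omega_limit phi x `<=` U ->
  exists n, forall m, n <= m -> U (phi (m, x)).
Proof.
move=> cK oU wU; apply: contrapT => nU.
have [||p [wp]] := omega_limit_frequently (~` U) cK.
- exact: open_closedC.
- move=> n; apply: contrapT => nC; apply: nU; exists n => m nm.
  by apply: contrapT => Um; apply: nC; exists m.
- by apply; apply: wU.
Qed.

Lemma omega_limit_sub_closed (C : set X) (n : nat) :
  closed C -> (forall m, n <= m -> C (phi (m, x))) ->
  omega_limit phi x `<=` C.
Proof.
move=> cC nC p /(_ n I); rewrite [X in _ -> X p]((closure_id C).1 cC).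
by apply: closure_subset => _ [m nm <-]; exact: nC.
Qed.

End OmegaLimit.

Lemma PA_setD_WA_sub_PA (X : topologicalType) (phi : nat * X -> X)
    (S T : set X) :
  PA phi S `\` WA phi (S `\` T) `<=` PA phi T.
Proof.
move=> x [wS nW] p wp; apply: contrapT => nT; apply: nW.
by exists p; split=> //; split=> //; apply: wS.
Qed.

Lemma barD_sub_PA_bar_limit_space (X : topologicalType) (phi : nat * X -> X)
    (eps : set (set X)) :
  barD phi eps `<=` PA phi (bar_limit_space eps).
Proof.
move=> x Dx p wp E /Dx[n nE].
exact: (omega_limit_sub_closed _ _ _ _ _ (@closed_closure _ E) nE p wp).
Qed.

Theorem theorem5p2 (X : topologicalType) (phi : nat * X -> X)
    (eps : set (set X))
    (hX : is_exterior_discrete_semiflow phi eps)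
    (hL : forall x, PA phi (bar_limit_space eps) x -> lagrange_stable_at phi x) :
  (PA phi (bar_limit_space eps)
     `\` WA phi (bar_limit_space eps `\` limit_space eps) `<=` barD phi eps)
  /\
  (WA phi (bar_limit_space eps `\` limit_space eps) = set0 ->
     attraction phi (bar_limit_space eps) = barD phi eps).
Proof.
have sub_barD : PA phi (bar_limit_space eps)
     `\` WA phi (bar_limit_space eps `\` limit_space eps) `<=` barD phi eps.
  move=> x Px E epsE.
  have oE := externology_open (exterior_semiflow_externology hX) epsE.
  have wE : omega_limit phi x `<=` E.
    by move=> p /(PA_setD_WA_sub_PA _ _ _ _ _ Px); apply.
  have [n nE] := omega_limit_eventually _ _ _ _ (hL _ Px.1) oE wE.
  by exists n => m /nE; apply: subset_closure.
split=> // W0; apply/seteqP; split=> x.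
  by move=> [_ Px]; apply: sub_barD; rewrite W0 setD0.
move=> /barD_sub_PA_bar_limit_space Px; split=> //.
by apply: omega_limit_nonempty; apply: hL.
Qed.
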